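(* The set of all Schauder-Orlicz decompositions (of Banach spaces) is strictly contained in the set of all Grinblyum-James orthogonal Schauder decompositions; that is, every Schauder-Orlicz decomposition is Grinblyum-James orthogonal, and there exists a Grinblyum-James orthogonal Schauder decomposition (of some Banach space) which is not a Schauder-Orlicz decomposition.
   Context: A Schauder decomposition of a Banach space $X$ is a sequence $\{\mathfrak{M}_n\}_{n=0}^{\infty}$ of closed nonzero linear subspaces of $X$ such that each $x\in X$ has a unique norm convergent expansion $x=\sum_{n=0}^{\infty}x_n$ with $x_n\in\mathfrak{M}_n$ for all $n$. Its associated sequence of coordinate projections (a.s.c.p.) $\{P_n\}_{n=0}^{\infty}$ is defined by $P_nx=x_n$; each $P_n$ is bounded. An Orlicz function is a continuous, nondecreasing, convex function $\Phi:[0,\infty)\to[0,\infty)$ with $\Phi(0)=0$ and $\lim_{t\to\infty}\Phi(t)=\infty$ (it may be degenerate, i.e. $\Phi(t)=0$ for some $t>0$). A Schauder decomposition of $X$ with a.s.c.p. $\{P_n\}$ is a Schauder-Orlicz decomposition if there exists an Orlicz function $\Phi$ such that for every $x\in X$: $\inf\{\rho>0:\sum_{n=0}^{\infty}\Phi(\|P_nx\|/\rho)\le 1\}=\|x\|$. For subspaces $\mathfrak{M},\mathfrak{N}$ of $X$ the inclination of $\mathfrak{M}$ to $\mathfrak{N}$ is $(\widehat{\mathfrak{M},\mathfrak{N}})=\inf\{\|x-y\|:x\in\mathfrak{M},\,y\in\mathfrak{N},\,\|x\|=1\}$. Put $\mathfrak{G}_n=\overline{\mathrm{Lin}}\{\mathfrak{M}_0,\ldots,\mathfrak{M}_n\}$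 and $\mathfrak{L}_{n,m}=\overline{\mathrm{Lin}}\{\mathfrak{M}_{n+1},\ldots,\mathfrak{M}_{n+m}\}$ (closed linear spans). The index $\gamma(\{\mathfrak{M}_n\})$ is the supremum of all $\delta$ such that $(\widehat{\mathfrak{G}_n,\mathfrak{L}_{n,m}})\ge\delta$ for all $n\ge0$, $m\ge1$; the decomposition is called (Grinblyum-James) orthogonal if $\gamma(\{\mathfrak{M}_n\})=1$. *)

(* Defs.v *)
From Stdlib Require Import Reals.
From Coquelicot Require Import Coquelicot.

Set Implicit Arguments.
Unset Strict Implicit.
Unset Printing Implicit Defensive.

Open Scope R_scope.

Section Decompositions.

Context {K : AbsRing} {X : CompleteNormedModule K}.

Definition is_subspace (D : X -> Prop) : Prop :=
  D zero /\
  (forall x y, D x -> D y -> D (plus x y)) /\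
  (forall (a : K) x, D x -> D (scal a x)).

Inductive lin (D : X -> Prop) : X -> Prop :=
| lin_incl x : D x -> lin D x
| lin_zero : lin D zero
| lin_plus x y : lin D x -> lin D y -> lin D (plus x y)
| lin_scal (a : K) x : lin D x -> lin D (scal a x).

Definition closure (D : X -> Prop) (x : X) : Prop :=
  forall U : X -> Prop, locally x U -> exists y, U y /\ D y.

Definition closed_lin (D : X -> Prop) : X -> Prop := closure (lin D).

Definition is_expansion (M : nat -> X -> Prop) (x : X) (u : nat -> X) : Prop :=
  (forall n, M n (u n)) /\ is_series u x.

Definition schauder_decomposition (M : nat -> X -> Prop) : Prop :=
  (forall n, is_subspace (M n) /\ closed (M n) /\ exists x, M n x /\ x <> zero) /\
  (forall x, exists! u, is_expansion M x u).

(* For a Schauder decomposition there is, by uniqueness of expansions, exactly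
   one such P up to pointwise equality. *)
Definition is_ascp (M : nat -> X -> Prop) (P : nat -> X -> X) : Prop :=
  forall x, is_expansion M x (fun n => P n x).

(* Functions on [0, oo) are represented by functions on R of which only the
   values on [0, oo) are constrained or used. *)
Definition orlicz_function (Phi : R -> R) : Prop :=
  (forall t, 0 <= t -> 0 <= Phi t) /\
  continuous_on (fun t => 0 <= t) Phi /\
  (forall s t, 0 <= s -> s <= t -> Phi s <= Phi t) /\
  (forall s t a, 0 <= s -> 0 <= t -> 0 <= a <= 1 ->
     Phi (a * s + (1 - a) * t) <= a * Phi s + (1 - a) * Phi t) /\
  Phi 0 = 0 /\
  is_lim Phi p_infty p_infty.

(* The terms of the series are nonnegative, so the sum is at most 1 in [0, oo]
   exactly when the series converges to a real number at most 1.  The infimum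
   of the empty set is p_infty. *)
Definition orlicz_norm (Phi : R -> R) (P : nat -> X -> X) (x : X) : Rbar :=
  Glb_Rbar (fun rho => 0 < rho /\
    exists s : R, is_series (fun n => Phi (norm (P n x) / rho)) s /\ s <= 1).

Definition schauder_orlicz_decomposition (M : nat -> X -> Prop) : Prop :=
  schauder_decomposition M /\
  exists P, is_ascp M P /\
  exists Phi, orlicz_function Phi /\
    forall x, orlicz_norm Phi P x = Finite (norm x).

Definition inclination (D E : X -> Prop) : Rbar :=
  Glb_Rbar (fun r => exists x y, D x /\ E y /\ norm x = 1 /\ r = norm (minus x y)).

Definition head_span (M : nat -> X -> Prop) (n : nat) : X -> Prop :=
  closed_lin (fun x => exists k, (k <= n)%nat /\ M k x).

Definition block_span (M : nat -> X -> Prop) (n m : nat) : X -> Prop :=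
  closed_lin (fun x => exists k, (n + 1 <= k <= n + m)%nat /\ M k x).

Definition gamma_index (M : nat -> X -> Prop) : Rbar :=
  Lub_Rbar (fun delta => forall n m, (1 <= m)%nat ->
    Rbar_le (Finite delta) (inclination (head_span M n) (block_span M n m))).

Definition gj_orthogonal_decomposition (M : nat -> X -> Prop) : Prop :=
  schauder_decomposition M /\ gamma_index M = Finite 1.

End Decompositions.

(* Main.v *)
Require Import Defs.
From Stdlib Require Import Reals Arith Lra Lia.
From Stdlib Require Import Classical ClassicalEpsilon FunctionalExtensionality.
From Stdlib Require Import PropExtensionality.
From Coquelicot Require Import Coquelicot.

(** Both halves rest on monotonicity: say that a decomposition is monotone when
    [norm x <= norm z] as soon as every coordinate of [x] has norm at most that
    of the same coordinate of [z].

    An Orlicz norm is computed from the numbers [norm (P n x)] through a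
    nondecreasing function, so a Schauder-Orlicz decomposition is monotone
    ([schauder_orlicz_monotone]).  A monotone decomposition is orthogonal
    ([monotone_gj_orthogonal]): if [x] lies in the span of [M 0, ..., M n] and
    [y] in the span of later subspaces, then the coordinates of [x] are those of
    [x - y] with the indices beyond [n] replaced by zero, whence
    [norm x <= norm (x - y)].  This passes to the closed spans by continuity of
    the norm.  The index cannot exceed 1, because [0] lies in every span and
    [M 0] has a unit vector.

    For strictness, an Orlicz norm does not see which index carries which
    coordinate norm; so in a Schauder-Orlicz decomposition all sums of two unit
    vectors taken from two different subspaces have the same norm
    ([schauder_orlicz_norm_pair]).  The coordinate decomposition of the space of
    null sequences normed by [sup_n (|x_n| + |x_(n+1)|)] is monotone but violates
    this invariance: [e_0 + e_1] has norm 2, whereas [e_0 + e_2] has norm 1.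
    The entries of the null sequences may lie in any Banach space [V] with a unit
    vector; taking [V] to be the scalar field handles the real and complex cases alike. *)

(** * Series with one nonzero term *)

Definition single {G : AbelianMonoid} (k : nat) (x : G) (n : nat) : G :=
  if Nat.eq_dec n k then x else zero.

Lemma single_eq {G : AbelianMonoid} (k : nat) (x : G) : single k x k = x.
Proof. unfold single; destruct (Nat.eq_dec k k); congruence. Qed.

Lemma single_neq {G : AbelianMonoid} (k n : nat) (x : G) :
  n <> k -> single k x n = zero.
Proof. unfold single; destruct (Nat.eq_dec n k); congruence. Qed.

Lemma sum_n_single {G : AbelianMonoid} (k : nat) (x : G) (N : nat) :
  sum_n (single k x) N = if le_dec k N then x else zero.
Proof.
  induction N as [|N IH].
  - rewrite sum_O; unfold single.
    destruct (Nat.eq_dec 0 k), (le_dec k 0); try lia; reflexivity.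
  - rewrite sum_Sn, IH; unfold single.
    destruct (Nat.eq_dec (S N) k), (le_dec k N), (le_dec k (S N)); try lia.
    + apply plus_zero_l.
    + apply plus_zero_r.
    + apply plus_zero_r.
Qed.

Lemma is_series_single {K : AbsRing} {V : NormedModule K} (k : nat) (x : V) :
  is_series (single k x) x.
Proof.
  apply filterlim_ext_loc with (fun _ => x).
  - exists k; intros N HN; rewrite sum_n_single.
    destruct (le_dec k N); [reflexivity | lia].
  - apply filterlim_const.
Qed.

(** * Orthogonality of monotone decompositions *)

(** The inequality between [x] and [y] needs only approximants [x'], [y'] that
    depend on the precision; this is what extends it from spans to closed spans. *)
Lemma norm_le_minus_limit {K : AbsRing} {V : NormedModule K} (x y : V) :
  (forall eps : posreal, exists x' y', norm (minus x' x) < eps /\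
     norm (minus y' y) < eps /\ norm x' <= norm (minus x' y')) ->
  norm x <= norm (minus x y).
Proof.
  intros Happrox; apply le_epsilon; intros eps Heps.
  assert (He : 0 < eps / 3) by lra.
  destruct (Happrox (mkposreal _ He)) as [x' [y' [Hx [Hy H]]]]; simpl in Hx, Hy.
  assert (H1 : norm (minus x' y') <=
               norm (minus x' x) + (norm (minus x y) + norm (minus y y'))).
  { rewrite (minus_trans x x' y'), (minus_trans y x y').
    eapply Rle_trans; [apply norm_triangle|].
    apply Rplus_le_compat_l, norm_triangle. }
  rewrite <- (norm_opp (minus y y')), opp_minus in H1.
  assert (H2 := norm_triangle_inv x' x).
  apply Rabs_le_between in H2; lra.
Qed.

Section Monotone.

Context {K : AbsRing} {X : CompleteNormedModule K}.
Local Notation XN := (CompleteNormedModule.NormedModule K X).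
Local Notation XM := (CompleteNormedModule.ModuleSpace K X).
Local Notation XG := (CompleteNormedModule.AbelianGroup K X).

Definition monotone_expansions (M : nat -> X -> Prop) : Prop :=
  forall x z u w, is_expansion M x u -> is_expansion M z w ->
    (forall n, norm (u n) <= norm (w n)) -> norm x <= norm z.

(** Finite sums of expansions are expansions, so membership in a span, which is
    defined inductively, can be read on the coordinates. *)
Lemma lin_expansion (M : nat -> X -> Prop) (S : nat -> Prop) (x : X) :
  (forall n, is_subspace (M n)) ->
  lin (fun y => exists k, S k /\ M k y) x ->
  exists u, is_expansion M x u /\ forall n, ~ S n -> u n = zero.
Proof.
  intros HM Hx; induction Hx as [x [k [Sk Mx]] | | x y _ [u [[Mu su] u0]] _ [v [[Mv sv] v0]]
                                | a x _ [u [[Mu su] u0]]].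
  - exists (single k x); split; [split|].
    + intros n; unfold single; destruct (Nat.eq_dec n k) as [->|]; [exact Mx|apply HM].
    + apply (is_series_single (V := XN)).
    + intros n Sn; apply single_neq; intros ->; contradiction.
  - exists (single 0 zero); split; [split|].
    + intros n; unfold single; destruct (Nat.eq_dec n 0); apply HM.
    + apply (is_series_single (V := XN)).
    + intros n _; unfold single; destruct (Nat.eq_dec n 0); reflexivity.
  - exists (fun n => plus (u n) (v n)); split; [split|].
    + intros n; apply HM; auto.
    + now apply (is_series_plus (V := XN)).
    + intros n Sn; rewrite u0, v0 by assumption; apply plus_zero_r.
  - exists (fun n => scal a (u n)); split; [split|].
    + intros n; apply HM; auto.
    + now apply (is_series_scal (V := XN)).
    + intros n Sn; rewrite u0 by assumption; exact (scal_zero_r (V := XM) a).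
Qed.

Lemma minus_expansion (M : nat -> X -> Prop) (x y : X) (u v : nat -> X) :
  (forall n, is_subspace (M n)) ->
  is_expansion M x u -> is_expansion M y v ->
  is_expansion M (minus x y) (fun n => minus (u n) (v n)).
Proof.
  intros HM [Mu su] [Mv sv]; split.
  - intros n; destruct (HM n) as [_ [Hp Hs]]; unfold minus.
    rewrite <- (scal_opp_one (V := XM)); auto.
  - now apply (is_series_minus (V := XN)).
Qed.

(** Up to index [n] the expansion of [x - y] agrees with that of [x], and beyond
    [n] the coordinates of [x] vanish; the result is monotonicity for this pair. *)
Lemma norm_le_minus_span (M : nat -> X -> Prop) (n m : nat) (x y : X) :
  (forall n, is_subspace (M n)) -> monotone_expansions M ->
  lin (fun x => exists k, (k <= n)%nat /\ M k x) x ->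
  lin (fun x => exists k, (n + 1 <= k <= n + m)%nat /\ M k x) y ->
  norm x <= norm (minus x y).
Proof.
  intros HM Hmono Hx Hy.
  destruct (lin_expansion M (fun k => (k <= n)%nat) x HM Hx) as [u [Hu u0]].
  destruct (lin_expansion M (fun k => (n + 1 <= k <= n + m)%nat) y HM Hy) as [v [Hv v0]].
  apply Hmono with (1 := Hu) (2 := minus_expansion M x y u v HM Hu Hv).
  intros k; destruct (le_dec k n) as [Hk|Hk].
  - rewrite v0 by lia; rewrite (minus_zero_r (G := XG)); apply Rle_refl.
  - rewrite u0 by assumption; apply Rle_trans with 0; [right; exact (norm_zero (V := XN))|].
    apply norm_ge_0.
Qed.

Lemma closure_approx (D : X -> Prop) (x : X) (eps : posreal) :
  closure D x -> exists y, D y /\ norm (minus y x) < eps.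
Proof.
  intros Hx.
  destruct (Hx (fun y => norm (minus y x) < eps)) as [y [Hy Dy]].
  - apply (locally_le_locally_norm (V := XN)); exists eps; intros y Hy; exact Hy.
  - now exists y.
Qed.

Lemma norm_le_minus_closed_span (M : nat -> X -> Prop) (n m : nat) (x y : X) :
  (forall n, is_subspace (M n)) -> monotone_expansions M ->
  head_span M n x -> block_span M n m y -> norm x <= norm (minus x y).
Proof.
  intros HM Hmono Hx Hy; apply (norm_le_minus_limit (V := XN)); intros eps.
  destruct (closure_approx _ x eps Hx) as [x' [Dx' Hx']].
  destruct (closure_approx _ y eps Hy) as [y' [Dy' Hy']].
  exists x', y'; repeat split; [exact Hx'|exact Hy'|].
  exact (norm_le_minus_span M n m x' y' HM Hmono Dx' Dy').
Qed.

(** For a unit vector [e] of [M 0], the pair of [e] and the zero vector shows that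
    the inclination for [n = 0], [m = 1] is at most 1, hence so is the index. *)
Lemma monotone_gj_orthogonal (M : nat -> X -> Prop) :
  schauder_decomposition M -> monotone_expansions M ->
  (exists x, M 0%nat x /\ norm x = 1) ->
  gj_orthogonal_decomposition M.
Proof.
  intros HS Hmono [e [Me He]]; split; [exact HS|].
  assert (HM : forall n, is_subspace (M n)) by (intros n; apply HS).
  apply is_lub_Rbar_unique; split.
  - intros delta Hdelta.
    apply Rbar_le_trans with (1 := Hdelta 0%nat 1%nat (le_n 1)).
    apply (proj1 (Glb_Rbar_correct _)).
    exists e, zero; split; [|split; [|split]].
    + intros U HU; exists e; split; [now apply locally_singleton|].
      apply lin_incl; exists 0%nat; auto.
    + intros U HU; exists zero; split; [now apply locally_singleton|].
      apply lin_zero.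
    + exact He.
    + now rewrite (minus_zero_r (G := XG)).
  - intros b Hb; apply Hb; intros n m _.
    apply (proj2 (Glb_Rbar_correct _)).
    intros r [x [y [Hx [Hy [Hnx ->]]]]]; simpl; rewrite <- Hnx.
    now apply (norm_le_minus_closed_span M n m).
Qed.

(** * Orthogonality of Schauder-Orlicz decompositions *)

(** Any [rho] admissible for [z] is admissible for [x], by comparison of the two
    series of nonnegative terms. *)
Lemma orlicz_norm_monotone (Phi : R -> R) (P : nat -> X -> X) (x z : X) :
  orlicz_function Phi -> (forall n, norm (P n x) <= norm (P n z)) ->
  Rbar_le (orlicz_norm Phi P x) (orlicz_norm Phi P z).
Proof.
  intros [Hpos [_ [Hmon _]]] HP.
  apply (proj2 (Glb_Rbar_correct _)).
  intros rho [Hrho [s [Hs Hs1]]].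
  apply (proj1 (Glb_Rbar_correct _)); split; [exact Hrho|].
  assert (Hdiv : forall y n, 0 <= norm (P n y) / rho).
  { intros y n; apply Rdiv_le_0_compat; [apply norm_ge_0|exact Hrho]. }
  assert (Hle : forall n, 0 <= Phi (norm (P n x) / rho) <= Phi (norm (P n z) / rho)).
  { intros n; split; [now apply Hpos|].
    apply Hmon; [apply Hdiv|].
    apply Rmult_le_compat_r; [left; now apply Rinv_0_lt_compat|apply HP]. }
  assert (Hz : ex_series (fun n => Phi (norm (P n z) / rho))) by now exists s.
  exists (Series (fun n => Phi (norm (P n x) / rho))); split.
  - apply Series_correct.
    apply (ex_series_le (V := R_CompleteNormedModule) _
             (fun n => Phi (norm (P n z) / rho))); [|exact Hz].
    intros n; change (Rabs (Phi (norm (P n x) / rho)) <= Phi (norm (P n z) / rho)).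
    rewrite Rabs_pos_eq; apply Hle.
  - apply Rle_trans with (2 := Hs1); rewrite <- (is_series_unique _ _ Hs).
    now apply Series_le.
Qed.

Lemma expansion_ascp (M : nat -> X -> Prop) (P : nat -> X -> X) (x : X) (u : nat -> X) :
  schauder_decomposition M -> is_ascp M P -> is_expansion M x u ->
  forall n, P n x = u n.
Proof.
  intros [_ HS] HP Hu n; destruct (HS x) as [w [_ Hw]].
  now rewrite <- (Hw _ Hu), (Hw _ (HP x)).
Qed.

Lemma schauder_orlicz_monotone (M : nat -> X -> Prop) :
  schauder_orlicz_decomposition M -> monotone_expansions M.
Proof.
  intros [HS [P [HP [Phi [HPhi Hnorm]]]]] x z u w Hu Hw Huw.
  change (Rbar_le (norm x) (norm z)); rewrite <- !Hnorm.
  apply orlicz_norm_monotone; [exact HPhi|]; intros n.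
  now rewrite (expansion_ascp M P x u), (expansion_ascp M P z w).
Qed.

End Monotone.

(** The norm axiom for scalar multiples is only an inequality, so scaling by
    [a = 1 / norm x] just gives [norm (scal a x) <= 1].  Equality follows by
    scaling back with [b = norm x]. *)
Lemma unit_multiple {K : AbsRing} {X : NormedModule K} (x : X) :
  K = R_AbsRing \/ K = C_AbsRing -> x <> zero ->
  exists a : K, norm (scal a x) = 1.
Proof.
  intros hK Hx.
  assert (Hr : 0 < norm x).
  { destruct (norm_ge_0 x) as [H|H]; [exact H|].
    now elim Hx; apply norm_eq_zero. }
  assert (Hab : exists a b : K, mult b a = one /\ abs a <= / norm x /\ abs b <= norm x).
  { revert Hr; generalize (norm x); intros r Hr.
    assert (Hinv : 0 < / r) by now apply Rinv_0_lt_compat.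
    destruct hK as [-> | ->].
    - exists (/ r), r; split; [|split].
      + apply Rinv_r, Rgt_not_eq, Hr.
      + change (Rabs (/ r) <= / r); rewrite Rabs_pos_eq; lra.
      + change (Rabs r <= r); rewrite Rabs_pos_eq; lra.
    - exists (RtoC (/ r)), (RtoC r); split; [|split].
      + change (RtoC r * RtoC (/ r) = RtoC 1)%C; rewrite <- RtoC_mult.
        now rewrite Rinv_r by (apply Rgt_not_eq, Hr).
      + change (Cmod (RtoC (/ r)) <= / r); rewrite Cmod_R, Rabs_pos_eq; lra.
      + change (Cmod (RtoC r) <= r); rewrite Cmod_R, Rabs_pos_eq; lra. }
  destruct Hab as [a [b [Hba [Ha Hb]]]]; exists a; apply Rle_antisym.
  - apply Rle_trans with (1 := norm_scal a x).
    rewrite <- (Rinv_l (norm x)) by now apply Rgt_not_eq.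
    apply Rmult_le_compat_r; [now left|exact Ha].
  - apply Rmult_le_reg_l with (1 := Hr); rewrite Rmult_1_r.
    rewrite <- (scal_one x) at 1; rewrite <- Hba, <- scal_assoc.
    apply Rle_trans with (1 := norm_scal b (scal a x)).
    apply Rmult_le_compat_r; [apply norm_ge_0|exact Hb].
Qed.

(** Orthogonality of the Schauder-Orlicz decompositions needs a unit vector in
    [M 0]; monotonicity supplies the rest. *)
Lemma schauder_orlicz_gj_orthogonal {K : AbsRing} {X : CompleteNormedModule K}
    (M : nat -> X -> Prop) :
  K = R_AbsRing \/ K = C_AbsRing ->
  schauder_orlicz_decomposition M -> gj_orthogonal_decomposition M.
Proof.
  intros hK HM; assert (HS := proj1 HM).
  apply monotone_gj_orthogonal; [exact HS|now apply schauder_orlicz_monotone|].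
  destruct (proj1 HS 0%nat) as [[_ [_ Hscal]] [_ [x [Mx Hx]]]].
  destruct (unit_multiple x hK Hx) as [a Ha].
  exists (scal a x); auto.
Qed.

(** * Invariance of Orlicz norms under permutation of the coordinates *)

(** The Orlicz series of [a + b] has at most two nonzero terms, both equal to
    [Phi (r / rho)], wherever they are placed; its sum, and with it the norm of
    [a + b], is determined by [Phi] and [r]. *)
Lemma schauder_orlicz_norm_pair {K : AbsRing} {X : CompleteNormedModule K}
    (M : nat -> X -> Prop) (r : R) :
  schauder_orlicz_decomposition M ->
  exists l : Rbar, forall i j a b, i <> j -> M i a -> M j b ->
    norm a = r -> norm b = r -> Finite (norm (plus a b)) = l.
Proof.
  intros [HS [P [HP [Phi [HPhi Hnorm]]]]].
  (* the Orlicz norm of a vector with two coordinates of norm r *)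
  exists (Glb_Rbar (fun rho => 0 < rho /\ Phi (r / rho) + Phi (r / rho) <= 1)).
  intros i j a b Hij Ha Hb Hna Hnb; rewrite <- Hnorm.
  assert (HPn : forall n, P n (plus a b) = plus (single i a n) (single j b n)).
  { apply (expansion_ascp M P); [exact HS|exact HP|]; split.
    - intros n; destruct (proj1 HS n) as [[M0 [Mplus _]] _]; unfold single.
      apply Mplus; [destruct (Nat.eq_dec n i) as [->|] | destruct (Nat.eq_dec n j) as [->|]];
        assumption.
    - apply (is_series_plus (V := CompleteNormedModule.NormedModule K X));
        apply (is_series_single (V := CompleteNormedModule.NormedModule K X)). }
  assert (Hterms : forall rho n, Phi (norm (P n (plus a b)) / rho) =
            plus (single i (Phi (r / rho)) n) (single j (Phi (r / rho)) n)).
  { intros rho n; rewrite HPn.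
    assert (Hz : Phi (norm (zero : X) / rho) = 0).
    { replace (norm (zero : X)) with 0
        by exact (eq_sym (norm_zero (V := CompleteNormedModule.NormedModule K X))).
      unfold Rdiv; rewrite Rmult_0_l; apply HPhi. }
    destruct (Nat.eq_dec n i) as [->|Hi]; [|destruct (Nat.eq_dec n j) as [->|Hj]].
    - rewrite !single_eq, !(single_neq j i) by assumption.
      rewrite !plus_zero_r; now rewrite Hna.
    - rewrite !single_eq, !(single_neq i j) by congruence.
      rewrite !plus_zero_l; now rewrite Hnb.
    - rewrite !single_neq by assumption.
      rewrite !plus_zero_l; exact Hz. }
  apply Glb_Rbar_eqset; intros rho; split; intros [Hrho Hs]; split; try exact Hrho.
  - destruct Hs as [s [Hs Hs1]]; apply Rle_trans with (2 := Hs1); right.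
    rewrite <- (is_series_unique _ _ Hs); symmetry; apply is_series_unique.
    eapply is_series_ext; [intros n; symmetry; apply Hterms|].
    apply (is_series_plus (V := R_NormedModule)); apply (is_series_single (V := R_NormedModule)).
  - exists (Phi (r / rho) + Phi (r / rho)); split; [|exact Hs].
    eapply is_series_ext; [intros n; symmetry; apply Hterms|].
    apply (is_series_plus (V := R_NormedModule)); apply (is_series_single (V := R_NormedModule)).
Qed.

(** * Null sequences with the norm [sup_n (|x_n| + |x_(n+1)|)] *)

Section NullSequences.

Context {K : AbsRing} {V : CompleteNormedModule K}.
Local Notation VN := (CompleteNormedModule.NormedModule K V).
Local Notation VM := (CompleteNormedModule.ModuleSpace K V).
Local Notation VG := (CompleteNormedModule.AbelianGroup K V).

Definition null_seq (x : nat -> V) : Prop :=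
  forall eps : posreal, eventually (fun n => norm (x n) < eps).

Definition c0 : Type := {x : nat -> V | null_seq x}.

Definition coord (p : c0) : nat -> V := proj1_sig p.
Coercion coord : c0 >-> Funclass.

Lemma c0_ext (p q : c0) : (forall n, p n = q n) -> p = q.
Proof.
  intros H; apply eq_sig_hprop; [intros; apply proof_irrelevance|].
  now apply functional_extensionality.
Qed.

Lemma null_seq_single (k : nat) (v : V) : null_seq (single k v).
Proof.
  intros eps; exists (S k); intros n Hn; rewrite single_neq by lia.
  apply Rle_lt_trans with 0; [right; exact (norm_zero (V := VN))|apply cond_pos].
Qed.

Lemma null_seq_zero : null_seq (fun _ => zero).
Proof.
  intros eps; exists 0%nat; intros n _.
  apply Rle_lt_trans with 0; [right; exact (norm_zero (V := VN))|apply cond_pos].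
Qed.

Lemma null_seq_plus (x y : nat -> V) :
  null_seq x -> null_seq y -> null_seq (fun n => plus (x n) (y n)).
Proof.
  intros Hx Hy eps; assert (He : 0 < eps / 2) by (destruct eps; simpl; lra).
  destruct (Hx (mkposreal _ He)) as [N1 H1], (Hy (mkposreal _ He)) as [N2 H2].
  exists (max N1 N2); intros n Hn; simpl in H1, H2.
  assert (A := H1 n ltac:(lia)); assert (B := H2 n ltac:(lia)).
  assert (C := norm_triangle (V := VN) (x n) (y n)).
  apply Rle_lt_trans with (1 := C); lra.
Qed.

Lemma null_seq_scal (a : K) (x : nat -> V) :
  null_seq x -> null_seq (fun n => scal a (x n)).
Proof.
  intros Hx eps.
  assert (Ha : 0 < abs a + 1) by (assert (H := abs_ge_0 a); lra).
  assert (He : 0 < eps / (abs a + 1)) by (apply Rdiv_lt_0_compat; [apply cond_pos|exact Ha]).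
  destruct (Hx (mkposreal _ He)) as [N H]; exists N; intros n Hn.
  specialize (H n Hn); simpl in H.
  apply Rle_lt_trans with (1 := norm_scal (V := VN) a (x n)).
  apply Rle_lt_trans with ((abs a + 1) * norm (x n)).
  - apply Rmult_le_compat_r; [apply norm_ge_0|lra].
  - apply Rmult_lt_compat_l with (1 := Ha) in H.
    replace ((abs a + 1) * (eps / (abs a + 1))) with (pos eps) in H by (field; lra).
    exact H.
Qed.

Lemma null_seq_opp (x : nat -> V) : null_seq x -> null_seq (fun n => opp (x n)).
Proof.
  intros Hx eps; destruct (Hx eps) as [N H]; exists N; intros n Hn.
  replace (norm (opp (x n))) with (norm (x n)) by exact (eq_sym (norm_opp (V := VN) (x n))).
  now apply H.
Qed.

Lemma null_seq_bounded (x : nat -> V) :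
  null_seq x -> exists B, forall n, norm (x n) <= B.
Proof.
  intros Hx; destruct (Hx (mkposreal 1 Rlt_0_1)) as [N HN]; simpl in HN.
  assert (Hfin : forall m, exists B, forall n, (n < m)%nat -> norm (x n) <= B).
  { induction m as [|m [B HB]]; [exists 0; intros n Hn; lia|].
    exists (Rmax B (norm (x m))); intros n Hn.
    destruct (Nat.eq_dec n m) as [->|Hm]; [apply Rmax_r|].
    apply Rle_trans with B; [apply HB; lia|apply Rmax_l]. }
  destruct (Hfin N) as [B HB]; exists (Rmax B 1); intros n.
  destruct (le_lt_dec N n) as [H|H].
  - apply Rle_trans with 1; [left; now apply HN|apply Rmax_r].
  - apply Rle_trans with B; [now apply HB|apply Rmax_l].
Qed.

Definition c0_zero : c0 := exist _ _ null_seq_zero.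
Definition c0_plus (p q : c0) : c0 :=
  exist _ _ (null_seq_plus _ _ (proj2_sig p) (proj2_sig q)).
Definition c0_opp (p : c0) : c0 := exist _ _ (null_seq_opp _ (proj2_sig p)).
Definition c0_scal (a : K) (p : c0) : c0 :=
  exist _ _ (null_seq_scal a _ (proj2_sig p)).

Definition c0_AbelianMonoid_mixin : AbelianMonoid.mixin_of c0.
Proof.
  exists c0_plus c0_zero.
  - intros p q; apply c0_ext; intros n; apply plus_comm.
  - intros p q s; apply c0_ext; intros n; apply plus_assoc.
  - intros p; apply c0_ext; intros n; exact (plus_zero_r (p n)).
Defined.

Canonical c0_AbelianMonoid := AbelianMonoid.Pack c0 c0_AbelianMonoid_mixin c0.

Definition c0_AbelianGroup_mixin : AbelianGroup.mixin_of c0_AbelianMonoid.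
Proof.
  exists c0_opp.
  intros p; apply c0_ext; intros n; exact (plus_opp_r (G := VG) (coord p n)).
Defined.

Canonical c0_AbelianGroup := AbelianGroup.Pack c0
  (AbelianGroup.Class c0 c0_AbelianMonoid_mixin c0_AbelianGroup_mixin) c0.

Definition c0_ModuleSpace_mixin : ModuleSpace.mixin_of K c0_AbelianGroup.
Proof.
  exists c0_scal.
  - intros a b p; apply c0_ext; intros n; exact (scal_assoc (V := VM) a b (coord p n)).
  - intros p; apply c0_ext; intros n; exact (scal_one (V := VM) (coord p n)).
  - intros a p q; apply c0_ext; intros n.
    exact (scal_distr_l (V := VM) a (coord p n) (coord q n)).
  - intros a b p; apply c0_ext; intros n.
    exact (scal_distr_r (V := VM) a b (coord p n)).
Defined.

Definition c0_ModuleSpace_class : ModuleSpace.class_of K c0 :=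
  ModuleSpace.Class K c0 (AbelianGroup.class c0_AbelianGroup) c0_ModuleSpace_mixin.

Canonical c0_ModuleSpace := ModuleSpace.Pack K c0 c0_ModuleSpace_class c0.

(** The uniform structure is that of uniform convergence.  The norm defined below
    lies between the supremum norm and its double, hence is compatible with it. *)
Definition c0_ball (p : c0) (eps : R) (q : c0) : Prop :=
  forall n, ball (p n) eps (q n).

Definition c0_UniformSpace_mixin : UniformSpace.mixin_of c0.
Proof.
  exists c0_ball.
  - exact c0_zero.
  - intros p e n; apply ball_center.
  - intros p q e H n; now apply ball_sym.
  - intros p q s e1 e2 H1 H2 n; now apply ball_triangle with (q n).
Defined.

Canonical c0_UniformSpace := UniformSpace.Pack c0 c0_UniformSpace_mixin c0.

Canonical c0_NormedModuleAux := NormedModuleAux.Pack K c0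
  (NormedModuleAux.Class K c0 c0_ModuleSpace_class c0_UniformSpace_mixin) c0.

(** The supremum is a real number because null sequences are bounded. *)
Definition c0_norm (p : c0) : R :=
  Lub_Rbar (fun r => exists n, r = norm (p n) + norm (p (S n))).

Lemma c0_norm_lub (p : c0) :
  is_lub_Rbar (fun r => exists n, r = norm (p n) + norm (p (S n))) (c0_norm p).
Proof.
  unfold c0_norm; destruct (Lub_Rbar_correct
    (fun r => exists n, r = norm (p n) + norm (p (S n)))) as [Hub Hleast].
  destruct (null_seq_bounded _ (proj2_sig p)) as [B HB].
  assert (HB2 : Rbar_le (Lub_Rbar (fun r => exists n, r = norm (p n) + norm (p (S n))))
                  (B + B)).
  { apply Hleast; intros r [n ->]; apply Rplus_le_compat; apply HB. }
  assert (H0 := Hub _ (ex_intro _ 0%nat eq_refl)).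
  destruct (Lub_Rbar _); try contradiction; now split.
Qed.

Lemma c0_norm_ge (p : c0) (n : nat) : norm (p n) + norm (p (S n)) <= c0_norm p.
Proof. apply (proj1 (c0_norm_lub p)); now exists n. Qed.

Lemma c0_norm_le (p : c0) (B : R) :
  (forall n, norm (p n) + norm (p (S n)) <= B) -> c0_norm p <= B.
Proof.
  intros H; apply (proj2 (c0_norm_lub p) B); intros r [n ->]; apply H.
Qed.

Lemma norm_coord_le (p : c0) (n : nat) : norm (p n) <= c0_norm p.
Proof.
  assert (H := c0_norm_ge p n); assert (H' := norm_ge_0 (V := VN) (p (S n))).
  lra.
Qed.

(** In [V], a ball of radius [eps] has norm radius below [norm_factor * eps], and
    two neighbouring entries contribute to each term of the supremum: this gives
    [2 * norm_factor], increased by 1 to keep the required inequality strict. *)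
Definition c0_NormedModule_mixin : NormedModule.mixin_of K c0_NormedModuleAux.
Proof.
  exists c0_norm (2 * norm_factor (V := VN) + 1).
  - intros p q; apply c0_norm_le; intros n.
    assert (H := c0_norm_ge p n); assert (H' := c0_norm_ge q n).
    assert (H1 := norm_triangle (V := VN) (coord p n) (coord q n)).
    assert (H2 := norm_triangle (V := VN) (coord p (S n)) (coord q (S n))).
    refine (Rle_trans _ _ _ (Rplus_le_compat _ _ _ _ H1 H2) _); lra.
  - intros a p; apply c0_norm_le; intros n.
    assert (H := Rmult_le_compat_l _ _ _ (abs_ge_0 a) (c0_norm_ge p n)).
    assert (H1 := norm_scal (V := VN) a (coord p n)).
    assert (H2 := norm_scal (V := VN) a (coord p (S n))).
    refine (Rle_trans _ _ _ (Rplus_le_compat _ _ _ _ H1 H2) _); lra.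
  - intros p q eps H n; apply (norm_compat1 (V := VN)).
    exact (Rle_lt_trans _ _ _ (norm_coord_le (minus q p) n) H).
  - intros p q eps H.
    apply Rle_lt_trans with (2 * (norm_factor (V := VN) * eps)).
    + apply c0_norm_le; intros n.
      assert (H1 := norm_compat2 (V := VN) _ _ _ (H n)).
      assert (H2 := norm_compat2 (V := VN) _ _ _ (H (S n))).
      refine (Rle_trans _ _ _ (Rlt_le _ _ (Rplus_lt_compat _ _ _ _ H1 H2)) _); lra.
    + assert (H1 := cond_pos eps); lra.
  - intros p Hp; apply c0_ext; intros n; apply (norm_eq_zero (V := VN)).
    apply Rle_antisym; [rewrite <- Hp; apply norm_coord_le|apply norm_ge_0].
Defined.

Definition c0_NormedModule_class : NormedModule.class_of K c0 :=
  NormedModule.Class K c0 (NormedModuleAux.class K c0_NormedModuleAux)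
    c0_NormedModule_mixin.

Canonical c0_NormedModule := NormedModule.Pack K c0 c0_NormedModule_class c0.

Lemma null_seq_uniform_limit (x : nat -> V) :
  (forall eps : posreal, exists p : c0, forall n, ball (x n) eps (p n)) -> null_seq x.
Proof.
  intros Hx eps; assert (Hf := norm_factor_gt_0 (V := VN)); assert (He := cond_pos eps).
  assert (He1 : 0 < eps / 2 / norm_factor (V := VN)) by (apply Rdiv_lt_0_compat; lra).
  assert (He2 : 0 < eps / 2) by lra.
  destruct (Hx (mkposreal _ He1)) as [p Hp].
  destruct (proj2_sig p (mkposreal _ He2)) as [N HN]; exists N; intros n Hn.
  specialize (HN n Hn); change (norm (p n) < eps / 2) in HN.
  assert (H := norm_compat2 (V := VN) _ _ _ (Hp n)); simpl in H.
  replace (norm_factor (V := VN) * (eps / 2 / norm_factor (V := VN)))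
    with (eps / 2) in H by (field; lra).
  assert (H' := norm_triangle_inv (V := VN) (p n) (x n)).
  apply Rabs_le_between in H'.
  assert (H'' := proj1 H').
  lra.
Qed.

(** The limit is computed in the complete space of all sequences. *)
Definition c0_pointwise_lim (F : (c0 -> Prop) -> Prop) : nat -> V :=
  lim (T := @fct_CompleteSpace nat V) (fun A => F (fun p => A (coord p))).

(** A limit operator must be total, whereas the limit sequence is known to be null
    only for Cauchy filters; the default value 0 covers the other filters. *)
Definition c0_lim (F : (c0 -> Prop) -> Prop) : c0 :=
  match excluded_middle_informative (null_seq (c0_pointwise_lim F)) with
  | left H => exist _ _ H
  | right _ => c0_zero
  end.

Definition c0_CompleteSpace_mixin : CompleteSpace.mixin_of c0_UniformSpace.
Proof.
  exists c0_lim.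
  - intros F HF HFc.
    assert (Hlim : forall eps : posreal,
               F (fun p => forall n, ball (c0_pointwise_lim F n) eps (coord p n))).
    { apply (complete_cauchy (T := @fct_CompleteSpace nat V)
               (fun A => F (fun p => A (coord p)))).
      - exact (filtermap_proper_filter c0 (nat -> V) coord F HF).
      - intros eps; destruct (HFc eps) as [p Hp]; now exists (coord p). }
    intros eps; unfold c0_lim.
    destruct (excluded_middle_informative _) as [H|H].
    + apply Hlim.
    + elim H; apply null_seq_uniform_limit; intros e.
      exact (filter_ex _ (Hlim e)).
  - intros F1 F2 H12 H21.
    replace F2 with F1; [apply close_refl|].
    apply functional_extensionality; intros A; apply propositional_extensionality.
    split; [apply H21|apply H12].
Defined.

Canonical c0_CompleteNormedModule := CompleteNormedModule.Pack K c0
  (CompleteNormedModule.Class K c0 c0_NormedModule_class c0_CompleteSpace_mixin) c0.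

(** * The coordinate decomposition *)

Definition c0_single (k : nat) (v : V) : c0 := exist _ _ (null_seq_single k v).

(** The sequences supported at [k]; they form an isometric copy of [V]. *)
Definition c0_axis (k : nat) (p : c0) : Prop := forall n, n <> k -> p n = zero.

Lemma c0_axis_eq (k : nat) (p : c0) : c0_axis k p -> p = c0_single k (p k).
Proof.
  intros Hp; apply c0_ext; intros n; change (p n = single k (p k) n).
  unfold single; destruct (Nat.eq_dec n k) as [->|H]; [reflexivity|now apply Hp].
Qed.

Lemma c0_single_axis (k : nat) (v : V) : c0_axis k (c0_single k v).
Proof. intros n Hn; exact (single_neq k n v Hn). Qed.

Lemma norm_c0_single (k : nat) (v : V) : norm (c0_single k v) = norm v.
Proof.
  apply Rle_antisym.
  - apply c0_norm_le; intros n.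
    change (norm (single k v n) + norm (single k v (S n)) <= norm v).
    assert (H0 : norm (zero : V) = 0) by exact (norm_zero (V := VN)).
    assert (Hv : 0 <= norm v) by exact (norm_ge_0 (V := VN) v).
    unfold single; destruct (Nat.eq_dec n k), (Nat.eq_dec (S n) k); try lia; lra.
  - apply Rle_trans with (2 := norm_coord_le (c0_single k v) k); right.
    change (norm v = norm (single k v k)); now rewrite single_eq.
Qed.

Lemma coord_sum_n (u : nat -> c0) (N k : nat) :
  (forall n, c0_axis n (u n)) ->
  (sum_n u N : c0) k = if le_dec k N then u k k else zero.
Proof.
  intros Hu; transitivity (sum_n (fun n => u n k) N).
  - induction N as [|N IH]; [now rewrite !sum_O|].
    rewrite !sum_Sn, <- IH; reflexivity.
  - refine (eq_trans _ (sum_n_single k (u k k) N)).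
    apply sum_n_ext; intros n; unfold single.
    destruct (Nat.eq_dec n k) as [->|H]; [reflexivity|apply Hu; congruence].
Qed.

(** Convergence in norm forces convergence of each coordinate, and the coordinate
    [k] of the partial sums is constant from [k] on.  Conversely, the remainder
    after [m] terms is [p] with its first entries erased, which is uniformly small
    since [p] is null. *)
Lemma is_series_axis (p : c0) (u : nat -> c0) :
  (forall n, c0_axis n (u n)) -> is_series u p <-> forall k, u k k = p k.
Proof.
  intros Hu; split.
  - intros Hs k.
    apply (filterlim_locally_unique (V := VN) (F := eventually) (fun N => (sum_n u N : c0) k)).
    + apply filterlim_ext_loc with (fun _ => u k k).
      * exists k; intros N HN; rewrite (coord_sum_n u N k Hu).
        destruct (le_dec k N); [reflexivity|lia].
      * apply filterlim_const.
    + apply filterlim_locally; intros eps.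
      generalize (proj1 (filterlim_locally (U := c0_UniformSpace) _ _) Hs eps).
      apply filter_imp; intros N HN; apply HN.
  - intros Hp; apply (filterlim_locally (U := c0_UniformSpace)); intros eps.
    destruct (proj2_sig p eps) as [N HN]; exists N; intros m Hm k.
    change (ball (p k) eps ((sum_n u m : c0) k)).
    rewrite (coord_sum_n u m k Hu).
    destruct (le_dec k m) as [Hk|Hk].
    + rewrite Hp; apply ball_center.
    + apply (norm_compat1 (V := VN)).
      rewrite <- (norm_opp (V := VN)), opp_minus, (minus_zero_r (G := VG)).
      apply HN; lia.
Qed.

Lemma closed_c0_axis (k : nat) : closed (c0_axis k).
Proof.
  intros p Hp n Hn; apply NNPP; intros Hpn.
  assert (Hpos : 0 < norm (coord p n) / norm_factor (V := VN)).
  { apply Rdiv_lt_0_compat; [|apply norm_factor_gt_0].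
    destruct (norm_ge_0 (V := VN) (coord p n)) as [H|H]; [exact H|].
    now elim Hpn; apply (norm_eq_zero (V := VN)). }
  apply Hp; exists (mkposreal _ Hpos); intros q Hq Haxis.
  assert (H := norm_compat2 (V := VN) _ _ _ (Hq n)); simpl in H.
  change (proj1_sig q n) with (coord q n) in H; rewrite (Haxis n Hn) in H.
  revert H; rewrite <- (norm_opp (V := VN)), opp_minus, (minus_zero_r (G := VG)).
  replace (norm_factor (V := VN) * (norm (coord p n) / norm_factor (V := VN)))
    with (norm (coord p n)) by (field; apply Rgt_not_eq, norm_factor_gt_0).
  apply Rlt_irrefl.
Qed.

Lemma subspace_c0_axis (k : nat) : is_subspace (c0_axis k).
Proof.
  split; [|split].
  - intros n _; reflexivity.
  - intros p q Hp Hq n Hn; change (plus (coord p n) (coord q n) = zero).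
    rewrite (Hp n Hn), (Hq n Hn); exact (plus_zero_r (G := VG) zero).
  - intros a p Hp n Hn; change (scal a (coord p n) = zero).
    rewrite (Hp n Hn); exact (scal_zero_r (V := VM) a).
Qed.

Lemma schauder_c0_axis (v : V) : v <> zero -> schauder_decomposition c0_axis.
Proof.
  intros Hv; split.
  - intros k; split; [apply subspace_c0_axis|split; [apply closed_c0_axis|]].
    exists (c0_single k v); split; [apply c0_single_axis|].
    intros H; apply Hv.
    rewrite <- (single_eq k v); change (single k v k) with (c0_single k v k).
    now rewrite H.
  - intros p; exists (fun n => c0_single n (coord p n)); split.
    + split; [intros n; apply c0_single_axis|].
      apply is_series_axis; [intros n; apply c0_single_axis|].
      intros k; exact (single_eq k (coord p k)).
    + intros w [Mw sw]; apply functional_extensionality; intros n.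
      rewrite (c0_axis_eq n (w n) (Mw n)).
      now rewrite (proj1 (is_series_axis p w Mw) sw n).
Qed.

(** Each [norm (u n)] is the norm of the single entry of [u n], and the norm of a
    sequence is a nondecreasing function of the norms of its entries. *)
Lemma monotone_c0_axis : monotone_expansions c0_axis.
Proof.
  intros p q u w [Mu su] [Mw sw] Huw.
  assert (H : forall n, norm (coord p n) <= norm (coord q n)).
  { intros n; generalize (Huw n).
    rewrite (c0_axis_eq n (u n) (Mu n)), (c0_axis_eq n (w n) (Mw n)).
    rewrite (proj1 (is_series_axis p u Mu) su n), (proj1 (is_series_axis q w Mw) sw n).
    intros H; rewrite <- (norm_c0_single n (coord p n)), <- (norm_c0_single n (coord q n)).
    exact H. }
  apply c0_norm_le; intros n.
  apply Rle_trans with (2 := c0_norm_ge q n); now apply Rplus_le_compat.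
Qed.

(** For a unit vector [v], placing two copies at the adjacent indices 0 and 1 gives
    norm 2; placing them at the indices 0 and 2 gives norm 1. *)
Lemma c0_axis_not_schauder_orlicz (v : V) :
  norm v = 1 -> ~ schauder_orlicz_decomposition c0_axis.
Proof.
  intros Hv HSO; destruct (schauder_orlicz_norm_pair c0_axis 1 HSO) as [l Hl].
  assert (H01 := Hl 0%nat 1%nat (c0_single 0 v) (c0_single 1 v) ltac:(lia)
    (c0_single_axis 0 v) (c0_single_axis 1 v)
    (eq_trans (norm_c0_single 0 v) Hv) (eq_trans (norm_c0_single 1 v) Hv)).
  assert (H02 := Hl 0%nat 2%nat (c0_single 0 v) (c0_single 2 v) ltac:(lia)
    (c0_single_axis 0 v) (c0_single_axis 2 v)
    (eq_trans (norm_c0_single 0 v) Hv) (eq_trans (norm_c0_single 2 v) Hv)).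
  rewrite <- H02 in H01; injection H01 as H; clear H02 Hl.
  assert (Hge : 2 <= norm (plus (c0_single 0 v) (c0_single 1 v))).
  { apply Rle_trans with (2 := c0_norm_ge _ 0).
    change (2 <= norm (plus v zero) + norm (plus zero v)).
    rewrite (plus_zero_r (G := VG)), (plus_zero_l (G := VG)); lra. }
  assert (Hle : norm (plus (c0_single 0 v) (c0_single 2 v)) <= 1).
  { apply c0_norm_le; intros n.
    change (norm (plus (single 0 v n) (single 2 v n)) +
            norm (plus (single 0 v (S n)) (single 2 v (S n))) <= 1).
    assert (H0 : norm (zero : V) = 0) by exact (norm_zero (V := VN)).
    destruct n as [|[|[|n]]]; unfold single; simpl;
      rewrite ?(plus_zero_r (G := VG)), ?(plus_zero_l (G := VG)); lra. }
  assert (H21 : 2 <= 1)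
    by exact (Rle_trans _ _ _ Hge (Rle_trans _ _ _ (Req_le _ _ H) Hle)).
  lra.
Qed.

End NullSequences.

Arguments c0_CompleteNormedModule {K} V.

Lemma gj_orthogonal_not_schauder_orlicz {K : AbsRing} (V : CompleteNormedModule K) (v : V) :
  norm v = 1 ->
  exists (X : CompleteNormedModule K) (M : nat -> X -> Prop),
    gj_orthogonal_decomposition M /\ ~ schauder_orlicz_decomposition M.
Proof.
  intros Hv; exists (c0_CompleteNormedModule V), c0_axis; split.
  - apply monotone_gj_orthogonal.
    + apply (schauder_c0_axis v); intros ->.
      apply R1_neq_R0; rewrite <- Hv.
      exact (norm_zero (V := CompleteNormedModule.NormedModule K V)).
    + apply monotone_c0_axis.
    + exists (c0_single 0 v); split; [apply c0_single_axis|].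
      exact (eq_trans (norm_c0_single 0 v) Hv).
  - now apply c0_axis_not_schauder_orlicz with v.
Qed.

Theorem proposition15 (K : AbsRing) (hK : K = R_AbsRing \/ K = C_AbsRing) :
  (forall (X : CompleteNormedModule K) (M : nat -> X -> Prop),
     schauder_orlicz_decomposition M -> gj_orthogonal_decomposition M) /\
  (exists (X : CompleteNormedModule K) (M : nat -> X -> Prop),
     gj_orthogonal_decomposition M /\ ~ schauder_orlicz_decomposition M).
Proof.
  split.
  - intros X M; now apply schauder_orlicz_gj_orthogonal.
  - destruct hK as [-> | ->].
    + exact (gj_orthogonal_not_schauder_orlicz R_CompleteNormedModule 1 Rabs_R1).
    + exact (gj_orthogonal_not_schauder_orlicz C_CompleteNormedModule (RtoC 1) Cmod_1).
Qed.
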